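(* Let $N$ be an odd positive integer and $\mu_N=\cos\frac{2\pi}{N+3}$. Let $z_k^{(0)}$, $\gamma_\ell^{(0)}$ and $a_\ell^{(0)}$ be as defined in the context, and put $a_\ell=a_\ell^{(0)}(\mu_N)$. Then for $j=1,\dots,(N-1)/2$ $$a_{2j+1}=\frac2{N+3}\Big[\mu_N U_{j-1}(\mu_N)U_j(\mu_N)+\Big(\frac{N+3}2-j\Big)(U_j(\mu_N))^2-\Big(\frac{N+1}2-j\Big)(U_{j-1}(\mu_N))^2\Big],$$ $$a_{2j}=\frac4{N+3}U_{j-1}(\mu_N)\Big[\Big(\frac{N+3}2-j\Big)U_j(\mu_N)-\mu_N\Big(\frac{N+1}2-j\Big)U_{j-1}(\mu_N)\Big].$$
   Context: $U_j$ ($j\ge0$) is the Chebyshev polynomial of the second kind, $U_j(\cos t)=\sin((j+1)t)/\sin t$. For odd $N$ define $z_N^{(0)}(x)=1$ and, for $k=1,\dots,(N-1)/2$, $$z_{2k-1}^{(0)}(x)=U_{k-1}(x)U_{k-1}(x),\qquad z_{2k}^{(0)}(x)=U_{k-1}(x)U_k(x).$$ For $\ell=1,\dots,N$ define $$\gamma_\ell^{(0)}(x)=\sum_{k=1}^{N-\ell+1}z_k^{(0)}(x)\,z_{k+\ell-1}^{(0)}(x),\qquad a_\ell^{(0)}(x)=\frac{\gamma_\ell^{(0)}(x)-\gamma_{\ell+2}^{(0)}(x)}{\gamma_1^{(0)}(x)-\gamma_3^{(0)}(x)},$$ with the convention that $\gamma_\ell^{(0)}=0$ for $\ell>N$. 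*)

(* Defs.v *)
From HB Require Import structures.
From mathcomp Require Import all_boot all_order all_algebra.
From mathcomp Require Import all_classical all_reals all_analysis.
From mathcomp Require Import ring.

Set Implicit Arguments.
Unset Strict Implicit.
Unset Printing Implicit Defensive.

Import Order.TTheory GRing.Theory Num.Theory.

Local Open Scope ring_scope.

(* Chebyshev polynomials of the second kind, by the three-term recurrence;
   [chebU_cos] below is the trigonometric characterisation. *)
Fixpoint chebU (R : nzRingType) (n : nat) : {poly R} :=
  match n with
  | 0 => 1
  | m.+1 => match m with
            | 0 => 2%:R *: 'X
            | k.+1 => 2%:R *: 'X * chebU R m - chebU R k
            end
  end.

Lemma chebU_cos_mul (R : realType) (n : nat) (t : R) :
  (chebU R n).[cos t] * sin t = sin (n.+1%:R * t).
Proof.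
suff: (chebU R n).[cos t] * sin t = sin (n.+1%:R * t) /\
      (chebU R n.+1).[cos t] * sin t = sin (n.+2%:R * t) by case.
elim: n => [|n [IH1 IH2]].
  rewrite /= hornerC hornerZ hornerX !mul1r; split=> //.
  have -> : 2%:R * t = t + t by ring.
  by rewrite sinD; ring.
split=> //.
have -> : chebU R n.+2 = 2%:R *: 'X * chebU R n.+1 - chebU R n by [].
rewrite hornerD hornerN hornerM hornerZ hornerX mulrBl IH1 -[_ * sin t]mulrA IH2.
have -> : n.+3%:R * t = n.+2%:R * t + t by rewrite -[n.+3]addn1 natrD; ring.
have -> : n.+1%:R * t = n.+2%:R * t - t.
  by rewrite -[n.+2]addn1 natrD; ring.
by rewrite sinB sinD; ring.
Qed.

Lemma chebU_cos (R : realType) (n : nat) (t : R) :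
  sin t != 0 -> (chebU R n).[cos t] = sin (n.+1%:R * t) / sin t.
Proof. by move=> st0; rewrite -chebU_cos_mul mulfK. Qed.

(* [z0 N k x] is z_k^{(0)}(x), meaningful for N odd and 1 <= k <= N: an odd
   k = 2m-1 has k./2 = m-1, and an even k = 2m has k./2 = m. *)
Definition z0 (R : realType) (N k : nat) (x : R) : R :=
  if k == N then 1
  else if odd k then (chebU R k./2).[x] * (chebU R k./2).[x]
  else (chebU R k./2.-1).[x] * (chebU R k./2).[x].

(* The range is 1 <= k <= N - l + 1; writing its strict bound as N + 2 - l
   makes it empty for l > N, in spite of truncated subtraction. *)
Definition gamma0 (R : realType) (N l : nat) (x : R) : R :=
  \sum_(1 <= k < N.+2 - l) z0 N k x * z0 N (k + l - 1) x.

Definition a0 (R : realType) (N l : nat) (x : R) : R :=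
  (gamma0 N l x - gamma0 N (l + 2) x) / (gamma0 N 1 x - gamma0 N 3 x).

Definition mu (R : realType) (N : nat) : R := cos (2%:R * pi / (N + 3)%:R).

Lemma z0_last (R : realType) (N : nat) (x : R) : z0 N N x = 1.
Proof. by rewrite /z0 eqxx. Qed.

Lemma z0_odd (R : realType) (N k : nat) (x : R) :
  odd N -> (1 <= k <= (N - 1)./2)%N ->
  z0 N (2 * k - 1) x = (chebU R (k - 1)).[x] * (chebU R (k - 1)).[x].
Proof.
case: k => // k oN /andP[_ kN]; rewrite /z0.
have -> : (2 * k.+1 - 1 = (k.*2).+1)%N by rewrite mul2n doubleS subn1.
rewrite /= odd_double uphalf_double subn1 /= ifN //.
apply: contraTneq kN => <-.
by rewrite subn1 /= doubleK ltnn.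
Qed.

Lemma z0_even (R : realType) (N k : nat) (x : R) :
  odd N -> (1 <= k <= (N - 1)./2)%N ->
  z0 N (2 * k) x = (chebU R (k - 1)).[x] * (chebU R k).[x].
Proof.
move=> oN _; rewrite /z0 mul2n odd_double doubleK subn1 ifN //.
by apply: contraTneq oN => <-; rewrite odd_double.
Qed.

Lemma gamma0_gt (R : realType) (N l : nat) (x : R) :
  (N < l)%N -> gamma0 N l x = 0.
Proof. by move=> Nl; rewrite /gamma0 big_geq // leq_subLR addn1. Qed.

(* Main.v *)
Require Import Defs.
From HB Require Import structures.
From mathcomp Require Import all_boot all_order all_algebra.
From mathcomp Require Import all_classical all_reals all_analysis.
From mathcomp Require Import ring zify.

Set Implicit Arguments.
Unset Strict Implicit.
Unset Printing Implicit Defensive.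

Import Order.TTheory GRing.Theory Num.Theory.

Local Open Scope ring_scope.

(** Put n = (N + 3) / 2 and s_k = U_(k-1), with s_0 = 0. Apart from one trigonometric
    fact, s_n (mu_N) = sin pi / sin (pi / n) = 0 with mu_N^2 <> 1, the proof is
    algebra with the recurrence s_(k+2) = 2 x s_(k+1) - s_k.

    All the z_k, including the exceptional z_N = 1, are instances of one formula,
    z_(2k-1) = s_k^2 and z_(2k) = s_k s_(k+1), in which z_0 = z_(N+1) = z_(N+2) = 0.
    Hence gamma_l and gamma_(l+2) can be summed over the same range:
      gamma_l - gamma_(l+2) = \sum_k z_k (z_(k+l-1) - z_(k+l+1))
                            = - \sum_k z_k s_(k+l+1),
    as z_(k+2) - z_k = s_(k+2) ([zfib_diff]). Since s_(2n) = 0 and s_(2n-1) = -1, the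
    sequence is antisymmetric, s_(2n-m) = - s_m ([chebS_refl]), which turns this
    correlation into a convolution ([gamma0_diff]),
      gamma_l - gamma_(l+2) = F (2n-1-l),  where F P = \sum_k z_k s_(P-k).

    The generating function of s is t / (1 - 2xt + t^2), so convolving with s
    inverts the recurrence: F (P+2) - 2x F (P+1) + F P = z_(P+1). This determines F
    for every x, and yields the closed form of [conv_closed]. At P = 2n-2 it gives
    gamma_1 - gamma_3 = n / (2 (1 - x^2)), and at the other arguments the reflection
    s_(n-m) = s_(n-1) s_m, in which s_(n-1)^2 = 1, expresses the result by s_j and
    s_(j+1). *)

(** * Chebyshev sequences started at zero *)

(** U_(k-1) at x, with U_(-1) = 0: starting at zero makes reflections and
    convolutions free of boundary terms. *)
Definition chebS (R : nzRingType) (x : R) (k : nat) : R :=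
  if k is i.+1 then (chebU R i).[x] else 0.

Lemma chebS0 (R : nzRingType) (x : R) : chebS x 0 = 0.
Proof. by []. Qed.

Lemma chebS1 (R : nzRingType) (x : R) : chebS x 1 = 1.
Proof. by rewrite /= hornerC. Qed.

Lemma chebSS (R : comNzRingType) (x : R) (k : nat) :
  chebS x k.+2 = 2%:R * x * chebS x k.+1 - chebS x k.
Proof.
case: k => [|k]; first by rewrite /= hornerZ hornerX hornerC mulr1 subr0.
have -> : chebS x k.+3 = (2%:R *: 'X * chebU R k.+1 - chebU R k).[x] by [].
by rewrite hornerD hornerN hornerM hornerZ hornerX.
Qed.

Lemma chebS_cassini (R : comNzRingType) (x : R) (k : nat) :
  chebS x k.+1 ^+ 2 - 2%:R * x * chebS x k.+1 * chebS x k + chebS x k ^+ 2 = 1.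
Proof.
elim: k => [|k IH]; first by rewrite chebS1 chebS0; ring.
by rewrite -[RHS]IH chebSS; ring.
Qed.

(** These are the addition formulas for the sine of (2k+1)t and (2k+2)t. *)
Lemma chebS_double (R : comNzRingType) (x : R) (k : nat) :
  chebS x k.*2.+1 = chebS x k.+1 ^+ 2 - chebS x k ^+ 2 /\
  chebS x k.*2.+2 = chebS x k.+1 * (chebS x k.+2 - chebS x k).
Proof.
elim: k => [|k [IH1 IH2]].
  by rewrite double0 chebSS chebS1 chebS0; split; ring.
rewrite doubleS.
have E : chebS x k.*2.+3 = chebS x k.+2 ^+ 2 - chebS x k.+1 ^+ 2.
  by rewrite chebSS IH2 IH1 chebSS; ring.
split=> //.
by rewrite chebSS E IH2 !chebSS; ring.
Qed.

(** Both sides satisfy the same recurrence in m, run downwards from a zero of the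
    sequence. *)
Lemma chebS_refl (R : comNzRingType) (x : R) (m k : nat) :
  chebS x (m + k).+1 = 0 -> chebS x k.+1 = chebS x (m + k) * chebS x m.
Proof.
move=> z.
suff H i : (i <= m)%N ->
    chebS x (m + k - i).+1 = chebS x (m + k) * chebS x i /\
    chebS x (m + k - i) = chebS x (m + k) * chebS x i.+1.
  by have [+ _] := H m (leqnn m); rewrite addKn.
elim: i => [_|i IH im]; first by rewrite subn0 z chebS0 chebS1 mulr0 mulr1.
have [H1 H2] := IH (ltnW im).
have E : (m + k - i = (m + k - i.+1).+1)%N by lia.
split; first by rewrite -E H2.
move: (chebSS x (m + k - i.+1)); rewrite -E H1 H2 => H3.
have -> : chebS x (m + k - i.+1) =
    2%:R * x * (chebS x (m + k) * chebS x i.+1) - chebS x (m + k) * chebS x i.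
  by rewrite H3; ring.
by rewrite chebSS; ring.
Qed.

Lemma chebS_pred_sqr (R : comNzRingType) (x : R) (k : nat) :
  chebS x k.+1 = 0 -> chebS x k ^+ 2 = 1.
Proof. by move=> z; rewrite -[RHS](chebS_cassini x k) z; ring. Qed.

(** * The sequence z and its convolution with s *)

(** The products s_k^2 (index 2k-1) and s_k s_(k+1) (index 2k) in one formula. *)
Definition zfib (R : nzRingType) (x : R) (k : nat) : R :=
  chebS x (uphalf k) * chebS x k./2.+1.

Lemma zfib0 (R : nzRingType) (x : R) : zfib x 0 = 0.
Proof. by rewrite /zfib mul0r. Qed.

Lemma zfib_even (R : nzRingType) (x : R) (q : nat) :
  zfib x q.*2 = chebS x q * chebS x q.+1.
Proof. by rewrite /zfib uphalf_double doubleK. Qed.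

Lemma zfib_odd (R : nzRingType) (x : R) (q : nat) :
  zfib x q.*2.+1 = chebS x q.+1 * chebS x q.+1.
Proof. by rewrite /zfib /= doubleK uphalf_double. Qed.

(** In both parities the difference factors as in [chebS_double]. *)
Lemma zfib_diff (R : comNzRingType) (x : R) (k : nat) :
  zfib x k.+2 - zfib x k = chebS x k.+2.
Proof.
rewrite -(odd_double_half k); case: (odd k); rewrite ?add1n ?add0n.
- rewrite -!doubleS !zfib_odd (chebS_double x _.+1).1; ring.
- rewrite -!doubleS !zfib_even doubleS (chebS_double x _).2; ring.
Qed.

Definition conv (R : nzRingType) (x : R) (P : nat) : R :=
  \sum_(0 <= k < P) zfib x k * chebS x (P - k).

Lemma convSS (R : comNzRingType) (x : R) (P : nat) :
  conv x P.+2 = 2%:R * x * conv x P.+1 - conv x P + zfib x P.+1.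
Proof.
rewrite /conv !big_nat_recr //= !(@subSn P) // subSnn subnn.
rewrite chebSS chebS1 chebS0.
have -> : \sum_(0 <= i < P) zfib x i * chebS x (P.+2 - i) =
    2%:R * x * (\sum_(0 <= i < P) zfib x i * chebS x (P.+1 - i))
    - \sum_(0 <= i < P) zfib x i * chebS x (P - i).
  rewrite mulr_sumr -sumrB; apply: eq_big_nat => i /andP[_ iP].
  have [iP1 iP2] : (i <= P)%N /\ (i <= P.+1)%N by split; lia.
  by rewrite !subSn // chebSS; ring.
ring.
Qed.

(** The right-hand sides satisfy the recurrence and initial values that determine
    the convolution. Both the sequence z and these formulas are quadratic forms in
    s_q and s_(q+1), so each step is a polynomial identity in x, s_q and s_(q+1). *)
Lemma conv_closed (R : comNzRingType) (x : R) (q : nat) :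
  2%:R * (1 - x ^+ 2) * conv x q.*2 =
    x * chebS x q.+1 * chebS x q + q.+1%:R * chebS x q ^+ 2
    - q%:R * chebS x q.+1 ^+ 2 /\
  2%:R * (1 - x ^+ 2) * conv x q.*2.+1 =
    2%:R * chebS x q.+1 * (q.+1%:R * chebS x q - x * q%:R * chebS x q.+1).
Proof.
elim: q => [|q [IH1 IH2]].
  rewrite double0 /conv big_nat1 big_geq // zfib0 chebS0 chebS1; split; ring.
rewrite doubleS.
set s := chebS x q in IH1 IH2 *; set t := chebS x q.+1 in IH1 IH2 *.
have E : 2%:R * (1 - x ^+ 2) * conv x q.*2.+2 =
    x * chebS x q.+2 * t + q.+2%:R * t ^+ 2 - q.+1%:R * chebS x q.+2 ^+ 2.
  rewrite convSS zfib_odd -/t.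
  transitivity (2%:R * x * (2%:R * (1 - x ^+ 2) * conv x q.*2.+1)
     - 2%:R * (1 - x ^+ 2) * conv x q.*2 + 2%:R * (1 - x ^+ 2) * t ^+ 2).
    by ring.
  rewrite IH1 IH2 chebSS -/s -/t -!natr1.
  ring.
split=> //.
rewrite convSS -doubleS zfib_even -/t.
transitivity (2%:R * x * (2%:R * (1 - x ^+ 2) * conv x q.*2.+2)
   - 2%:R * (1 - x ^+ 2) * conv x q.*2.+1
   + 2%:R * (1 - x ^+ 2) * (t * chebS x q.+2)).
  by rewrite doubleS; ring.
rewrite E IH2 chebSS -/s -/t -!natr1.
ring.
Qed.

(** * From correlations to the convolution *)

(** From here on N = 2n+1, so that (N + 3) / 2 is [n.+2]: the zero of the sequence
    sits at [n.+2], and the exceptional value z_N = 1 is the square of the term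
    before it. *)
Lemma z0_zfib (R : realType) (n k : nat) (x : R) :
  chebS x n.+2 = 0 -> (0 < k)%N -> z0 n.*2.+1 k x = zfib x k.
Proof.
move=> z k0; rewrite /z0; case: eqP => [->|_].
  by rewrite zfib_odd -expr2 chebS_pred_sqr.
rewrite -(odd_double_half k) in k0 *; case: (odd k) k0; rewrite /= => k0.
  by rewrite add1n zfib_odd /= odd_double uphalf_double.
rewrite add0n odd_double zfib_even doubleK.
by case: (k./2) k0.
Qed.

(** Starting at k = 0, where z vanishes, makes the upper bound the only place where
    the sum for l + 2 is shorter than the sum for l. *)
Lemma gamma0_zfib (R : realType) (n l : nat) (x : R) :
  chebS x n.+2 = 0 ->
  gamma0 n.*2.+1 l.+1 x =
    \sum_(0 <= k < n.*2.+2 - l) zfib x k * zfib x (k + l).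
Proof.
move=> z; rewrite /gamma0 subSS.
have [ln|nl] := ltnP l n.*2.+2; last first.
  by rewrite !big_geq //; lia.
rewrite [RHS]big_ltn ?subn_gt0 // zfib0 mul0r add0r.
apply: eq_big_nat => k /andP[k0 _].
by rewrite !z0_zfib // addnS subn1 //= addn_gt0 k0.
Qed.

(** Over a common range the difference is minus a correlation of z with s;
    antisymmetry of s under m |-> 2 (n+2) - m makes it a convolution. *)
Lemma gamma0_diff (R : realType) (n l : nat) (x : R) :
  chebS x n.+2 = 0 -> (l <= n.*2)%N ->
  gamma0 n.*2.+1 l.+1 x - gamma0 n.*2.+1 l.+3 x = conv x (n.*2.+2 - l).
Proof.
move=> z ln; rewrite !gamma0_zfib //.
set P := (n.*2.+2 - l)%N.
have [p PE] : exists p, P = p.+2 by exists (n.*2 - l)%N; rewrite /P; lia.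
have -> : (n.*2.+2 - l.+2 = p)%N by rewrite /P in PE; lia.
(* the two products added to the sum for l.+3 vanish with z_(N+1) and z_(N+2) *)
have -> : \sum_(0 <= k < p) zfib x k * zfib x (k + l.+2) =
          \sum_(0 <= k < P) zfib x k * zfib x (k + l.+2).
  rewrite PE !big_nat_recr //=.
  have -> : (p + l.+2 = n.+1.*2)%N by rewrite /P in PE; lia.
  have -> : (p.+1 + l.+2 = n.+1.*2.+1)%N by rewrite /P in PE; lia.
  by rewrite zfib_even zfib_odd z !mulr0 !addr0.
rewrite -sumrB /conv; apply: eq_big_nat => k /andP[_ kP].
rewrite -mulrBr -opprB !addnS zfib_diff; congr (_ * _).
have Ek : (P - k + (k + l).+1 = n.+1.*2.+1)%N by rewrite /P in kP *; lia.
rewrite (@chebS_refl _ x (P - k)); last first.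
  by rewrite Ek (chebS_double x n.+1).2 z mul0r.
by rewrite Ek (chebS_double x n.+1).1 z (chebS_pred_sqr z); ring.
Qed.

(** * The coefficients at a root *)

(** The formulas hold at every root x of U_(n+1) other than 1 and -1: the sign
    [chebS x n.+1] of the reflection cancels, since they are quadratic in s. *)
Lemma a0_root (R : realType) (n j : nat) (x : R) :
  chebS x n.+2 = 0 -> 1 - x ^+ 2 != 0 -> (1 <= j <= n)%N ->
  a0 n.*2.+1 j.*2.+1 x =
    n.+2%:R^-1 * (x * chebS x j * chebS x j.+1
      + (n.+2%:R - j%:R) * chebS x j.+1 ^+ 2
      - (n.+1%:R - j%:R) * chebS x j ^+ 2) /\
  a0 n.*2.+1 j.*2 x =
    2%:R / n.+2%:R * chebS x j *
      ((n.+2%:R - j%:R) * chebS x j.+1 - x * (n.+1%:R - j%:R) * chebS x j).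
Proof.
move=> z x1 /andP[j0 jn].
set w := 2%:R * (1 - x ^+ 2).
have w0 : w != 0 by rewrite mulf_neq0 // pnatr_eq0.
have n0 : n.+2%:R != 0 :> R by rewrite pnatr_eq0.
have e2 := chebS_pred_sqr z.
have D1 : w * (gamma0 n.*2.+1 1 x - gamma0 n.*2.+1 3 x) = n.+2%:R.
  by rewrite gamma0_diff // subn0 -doubleS (conv_closed x _).1 z e2; ring.
have d0 : gamma0 n.*2.+1 1 x - gamma0 n.*2.+1 3 x != 0.
  by apply: contraNneq n0 => d; rewrite -D1 d mulr0.
have a0E l : (l <= n.*2)%N ->
    a0 n.*2.+1 l.+1 x = n.+2%:R^-1 * (w * conv x (n.*2.+2 - l)).
  move=> ln; rewrite /a0 addn2 gamma0_diff // -D1.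
  by rewrite invfM; field; rewrite d0 w0.
pose q := (n - j)%N.
have sq1 : chebS x q.+2 = chebS x n.+1 * chebS x j.
  have E : (j + q.+1 = n.+1)%N by rewrite /q; lia.
  by rewrite (@chebS_refl _ x j) E.
have sq : chebS x q.+1 = chebS x n.+1 * chebS x j.+1.
  have E : (j.+1 + q = n.+1)%N by rewrite /q; lia.
  by rewrite (@chebS_refl _ x j.+1) E.
have qE i : (q + i)%:R = (n + i)%:R - j%:R :> R.
  by rewrite -natrB; [congr (_%:R); rewrite /q; lia | lia].
have q1 : q.+1%:R = n.+1%:R - j%:R :> R by rewrite -addn1 qE addn1.
have q2 : q.+2%:R = n.+2%:R - j%:R :> R by rewrite -addn2 qE addn2.
have [c1 c2] := conv_closed x q.+1.
split.
  rewrite a0E; last by rewrite leq_double.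
  have -> : (n.*2.+2 - j.*2 = q.+1.*2)%N by rewrite /q; lia.
  rewrite c1 sq sq1 q1 q2; congr (_ * _).
  by rewrite -[RHS]mul1r -e2; ring.
have jE : j.*2 = j.*2.-1.+1 by lia.
rewrite jE a0E; last by lia.
have -> : (n.*2.+2 - j.*2.-1 = q.+1.*2.+1)%N by rewrite /q; lia.
rewrite c2 sq sq1 q1 q2 -[RHS]mul1r -e2; ring.
Qed.

Lemma mu_root (R : realType) (n : nat) :
  let x := mu R n.*2.+1 in chebS x n.+2 = 0 /\ 1 - x ^+ 2 != 0.
Proof.
rewrite /mu; set t := 2%:R * pi / _.
have n0 : n.+2%:R != 0 :> R by rewrite pnatr_eq0.
have tE : n.+2%:R * t = pi.
  rewrite /t; have -> : (n.*2.+1 + 3 = 2 * n.+2)%N by lia.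
  by rewrite natrM; move: (n.+2%:R) n0 => y y0; field.
have st : sin t != 0.
  have t0 : 0 < t by rewrite -(pmulr_rgt0 _ (ltr0Sn R n.+1)) tE pi_gt0.
  rewrite gt_eqF // sin_gt0_pi // t0 /= -tE ltr_pMl //.
  by rewrite ltr1n.
split; last by rewrite -sin2cos2 expf_neq0.
by rewrite /chebS chebU_cos // tE sinpi mul0r.
Qed.

Theorem theorem4p2 (R : realType) (N : nat) (oddN : odd N)
    (j : nat) (hj : (1 <= j <= (N - 1)./2)%N) :
  let m : R := mu R N in
  let U (i : nat) : R := (chebU R i).[m] in
  a0 N (2 * j + 1) m =
    2%:R / (N + 3)%:R *
      (m * U (j - 1)%N * U j
       + ((N + 3)%:R / 2%:R - j%:R) * U j ^+ 2
       - ((N + 1)%:R / 2%:R - j%:R) * U (j - 1)%N ^+ 2)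
  /\
  a0 N (2 * j) m =
    4%:R / (N + 3)%:R * U (j - 1)%N *
      (((N + 3)%:R / 2%:R - j%:R) * U j
       - m * ((N + 1)%:R / 2%:R - j%:R) * U (j - 1)%N).
Proof.
move=> m U.
have [n NE] : exists n, N = n.*2.+1.
  by exists N./2; rewrite -{1}(odd_double_half N) oddN.
have jn : (1 <= j <= n)%N by move: hj; rewrite NE subn1 /= doubleK.
have [z x1] : chebS m n.+2 = 0 /\ 1 - m ^+ 2 != 0.
  by rewrite /m NE; exact: mu_root.
have [odda evena] := a0_root z x1 jn.
have E3 : (N + 3)%:R = 2%:R * n.+2%:R :> R by rewrite -natrM; congr (_%:R); lia.
have E1 : (N + 1)%:R = 2%:R * n.+1%:R :> R by rewrite -natrM; congr (_%:R); lia.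
have t0 : 2%:R != 0 :> R by rewrite pnatr_eq0.
have divK y : 2%:R * y / 2%:R = y :> R by rewrite mulrC mulKf.
have Uj1 : U (j - 1)%N = chebS m j by case: (j) jn => // i _; rewrite subn1.
have Uj : U j = chebS m j.+1 by [].
rewrite E3 E1 !divK Uj1 Uj mul2n addn1 NE odda evena.
have i2 : 2%:R / (2%:R * n.+2%:R) = n.+2%:R^-1 :> R.
  by rewrite invfM mulrA divff // mul1r.
by rewrite i2 (natrM R 2 2) -[2%:R * 2%:R / _]mulrA i2.
Qed.
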